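(* Let $k$ be a field, $R=k[x_1,\dots,x_n]$, and let $I\subseteq R$ be the edge ideal of a hypergraph $\mathcal H$ on the vertex set $V=\{1,\dots,n\}$. For a subset $C\subseteq V$, the prime ideal $P_C=(x_i\mid i\in C)$ is an associated prime of $I^2$ (that is, of the $R$-module $R/I^2$) if and only if the hypergraph $\mathcal H_C$ has a 2-saturating set.
   Context: A hypergraph $\mathcal H$ on a finite vertex set $V$ is a set of subsets of $V$ (its edges); containments between edges are allowed. For $F\subseteq V$ put $x^F=\prod_{i\in F}x_i$. The edge ideal of $\mathcal H$ is the ideal generated by all $x^F$, $F\in\mathcal H$. For $C\subseteq V$, the induced subhypergraph is $\mathcal H_C=\{F\cap C\mid F\in\mathcal H\}$, a hypergraph on the vertex set $C$. Let $\mathcal K$ be a hypergraph on a vertex set $W$. A set $U\subseteq W$ is decomposable in $\mathcal K$ if $U$ can be partitioned into two (possibly empty) disjoint subsets each of which contains an edge of $\mathcal K$; otherwise $U$ is indecomposable. (So every $U$ is decomposable if $\emptyset$ is an edge.) For $i\in W$ set $\mathcal K(i)=\{F\setminus\{i\}\mid F\in\mathcal K\}$. A set $U\subseteq W$ is a 2-saturating set of $\mathcal K$ if $U$ is indecomposable in $\mathcal K$ and, for every $i\in W$, $U\setminus\{i\}$ is decomposable in $\mathcal K(i)$. *)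

(* Defs.v *)
From HB Require Import structures.
From mathcomp Require Import all_boot all_order all_algebra.
From mathcomp Require Export mpoly.

Set Implicit Arguments.
Unset Strict Implicit.
Unset Printing Implicit Defensive.

Import GRing.Theory.
Local Open Scope ring_scope.

(* Membership in a polynomial ideal is not a boolean predicate a priori, so
   ideals are Prop-valued here, unlike the idealr structures of
   ring_quotient. *)
Section Ideals.
Variable R : comNzRingType.
Implicit Types (S I J P : R -> Prop).

Definition is_ideal I : Prop :=
  [/\ I 0, forall x y, I x -> I y -> I (x + y) & forall a x, I x -> I (a * x)].

Definition is_prime_ideal P : Prop :=
  [/\ is_ideal P, ~ P 1 & forall x y, P (x * y) -> P x \/ P y].

Definition ideal_gen S : R -> Prop := fun x =>
  exists s : seq (R * R),
    (forall p, p \in s -> S p.2) /\ x = \sum_(p <- s) p.1 * p.2.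

Definition ideal_mul I J : R -> Prop :=
  ideal_gen (fun x => exists a b, [/\ I a, J b & x = a * b]).

(* The annihilator in R of the class of f in R / J. *)
Definition ann_quot J (f : R) : R -> Prop := fun g => J (g * f).

(* Associated primes of the R-module R / J: the prime ideals that are the
   annihilator of an element of R / J, given by a representative f. *)
Definition associated_prime_quot J P : Prop :=
  is_prime_ideal P /\ exists f : R, forall g, P g <-> ann_quot J f g.

End Ideals.

(* A hypergraph is given by its set of edges K : {set {set T}}; its vertex set
   W : {set T} is a separate argument wherever it matters. *)
Section Hypergraphs.
Variable T : finType.
Implicit Types (H K : {set {set T}}) (C U W : {set T}).

Definition induced_hypergraph H C : {set {set T}} := [set F :&: C | F in H].

Definition contains_edge K U : Prop := exists2 F, F \in K & F \subset U.

Definition decomposable K U : Prop :=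
  exists U1 U2 : {set T},
    [/\ U1 :|: U2 = U, [disjoint U1 & U2],
        contains_edge K U1 & contains_edge K U2].

Definition remove_vertex K (i : T) : {set {set T}} := [set F :\ i | F in K].

Definition two_saturating W K U : Prop :=
  [/\ U \subset W, ~ decomposable K U &
      forall i, i \in W -> decomposable (remove_vertex K i) (U :\ i)].

End Hypergraphs.

Section EdgeIdeals.
Variables (k : fieldType) (n : nat).

Definition sqfree_monomial (F : {set 'I_n}) : {mpoly k[n]} :=
  \prod_(i in F) 'X_i.

Definition edge_ideal (H : {set {set 'I_n}}) : {mpoly k[n]} -> Prop :=
  ideal_gen (fun g => exists2 F, F \in H & g = sqfree_monomial F).

Definition variable_ideal (C : {set 'I_n}) : {mpoly k[n]} -> Prop :=
  ideal_gen (fun g => exists2 i, i \in C & g = 'X_i).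

End EdgeIdeals.

Arguments edge_ideal k {n} H _.
Arguments variable_ideal k {n} C _.

(* Main.v *)
Require Import Defs.
From mathcomp Require Import all_boot all_order all_algebra.
From mathcomp Require Import mpoly.
From mathcomp Require Import zify.

(** Inverting the variables outside [C] reduces the question to monomials in
    the variables of [C]: writing [J] for the square of the edge ideal of [H_C],
    [P_C] is associated to [I^2] iff some monomial [x^a], with [a] supported on
    [C], lies outside [J] while [x_i x^a] lies in [J] for every [i] in [C].
    The inversion amounts to multiplying by the square of the product of the
    variables outside [C], as exponents in products of two edges are at most 2.
    For the same reason such an [a] has entries at most 1, so it is the
    indicator of a set [U], which is 2-saturating.  Conversely, [U] being
    2-saturating only says that [J] contains [x_i^2 x^U] for each [i] in [C],
    but not [x^U] itself; multiplying [x^U] by a maximal squarefree monomial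
    [x^D] such that the product stays outside [J] gives the desired [x^a]. *)

Import GRing.Theory.
Local Open Scope ring_scope.

(** * Ideals given by generators *)

Section Ideals.
Set Implicit Arguments.
Unset Strict Implicit.
Variable R : comNzRingType.
Implicit Types (S I : R -> Prop).

Lemma ideal_gen_ideal S : is_ideal (ideal_gen S).
Proof.
split.
- by exists [::]; split=> //; rewrite big_nil.
- move=> x y [s [sS ->]] [t [tS ->]]; exists (s ++ t); rewrite big_cat.
  by split=> // p; rewrite mem_cat => /orP []; [apply: sS | apply: tS].
- move=> a x [s [sS ->]]; exists [seq (a * p.1, p.2) | p <- s]; split.
    by move=> _ /mapP [p ps ->]; exact: (sS p ps).
  by rewrite big_map mulr_sumr; apply: eq_bigr => p _; rewrite mulrA.
Qed.

Lemma ideal_gen_mem S x : S x -> ideal_gen S x.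
Proof.
move=> Sx; exists [:: (1, x)]; rewrite big_seq1 mul1r; split=> // p.
by rewrite inE => /eqP ->.
Qed.

Lemma ideal_sum I (T : eqType) (s : seq T) (F : T -> R) :
  is_ideal I -> (forall t, t \in s -> I (F t)) -> I (\sum_(t <- s) F t).
Proof.
move=> [I0 ID _] sI; rewrite big_seq.
by apply: (big_ind I) => // t; apply: sI.
Qed.

Lemma ideal_gen_sub S I :
  is_ideal I -> (forall x, S x -> I x) -> forall x, ideal_gen S x -> I x.
Proof.
move=> Iid SI x [s [sS ->]]; apply: ideal_sum => // p ps.
by case: Iid => _ _; apply; apply: SI; apply: sS.
Qed.

End Ideals.

(** * Monomial ideals *)

Section MonomialIdeals.
Set Implicit Arguments.
Unset Strict Implicit.
Variables (k : fieldType) (n : nat).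
Implicit Types (Q : 'X_{1..n} -> Prop) (I J : {mpoly k[n]} -> Prop).

(** Membership is tested term by term; this is an ideal once [Q] is closed under adding
    exponents. *)
Definition monomial_ideal Q (f : {mpoly k[n]}) : Prop :=
  forall m, m \in msupp f -> Q m.

Lemma monomial_ideal_ideal Q :
  (forall m m', Q m -> Q (m' + m)%MM) -> is_ideal (monomial_ideal Q).
Proof.
move=> Qup; split.
- by move=> m; rewrite msupp0.
- move=> f g fQ gQ m /msuppD_le.
  by rewrite mem_cat => /orP [/fQ|/gQ].
- move=> f g gQ _ /msuppM_le /allpairsP [[m m'] /= [_ /gQ gm' ->]].
  exact: Qup.
Qed.

Lemma monomial_idealX Q m : Q m -> monomial_ideal Q 'X_[m].
Proof. by move=> Qm m' /mem_msuppXP <-. Qed.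

Lemma monomial_ideal_sub Q I : is_ideal I -> (forall m, Q m -> I 'X_[m]) ->
  forall f, monomial_ideal Q f -> I f.
Proof.
move=> Iid QI f fQ; rewrite [f]mpolyE; apply: ideal_sum => // m /fQ Qm.
by rewrite -mul_mpolyC; case: Iid => _ _; apply; apply: QI.
Qed.

Lemma sqfree_monomialE (F : {set 'I_n}) :
  sqfree_monomial k F = 'X_[mesym1 F].
Proof.
rewrite mpolyXE_id /sqfree_monomial big_mkcond /=; apply: eq_bigr => i _.
by rewrite mnmE; case: (i \in F); rewrite ?expr1 ?expr0.
Qed.

End MonomialIdeals.

(** * The square of an edge ideal, through exponents *)

Section SquareOfEdgeIdeal.
Set Implicit Arguments.
Unset Strict Implicit.
Variables (k : fieldType) (n : nat) (H : {set {set 'I_n}}).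
Implicit Types (C U D F G : {set 'I_n}) (a b : 'I_n -> nat).

(* The exponent [a], restricted to [C], is that of a monomial in the square of
   the edge ideal of the induced hypergraph [H_C]. *)
Definition in_square C a : bool :=
  [exists F in H, exists G in H, forall i in C, ((i \in F) + (i \in G) <= a i)%N].

Lemma in_squareP C a :
  reflect (exists F G, [/\ F \in H, G \in H &
             forall i, i \in C -> (i \in F) + (i \in G) <= a i])%N
          (in_square C a).
Proof.
apply: (iffP exists_inP) => [[F FH /exists_inP [G GH /forall_inP le]]|].
  by exists F, G.
move=> [F [G [FH GH le]]]; exists F => //.
by apply/exists_inP; exists G => //; apply/forall_inP.
Qed.

(* Entries beyond 2 are immaterial. *)
Lemma in_square_le C a b :
  (forall i, i \in C -> a i <= b i \/ 2 <= b i)%N ->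
  in_square C a -> in_square C b.
Proof.
move=> le /in_squareP [F [G [FH GH leFG]]]; apply/in_squareP; exists F, G.
split=> // i iC; have := leFG i iC; case: (le i iC) => [|le2]; first lia.
by move: le2; case: (i \in F); case: (i \in G) => /=; lia.
Qed.

(** Two edges contribute at most 2 to any exponent, so the entries of [b] on [D] outside [C] impose
    no condition. *)
Lemma in_square_invert C D a b : C \subset D ->
  (forall i, i \in C -> a i = b i) ->
  (forall i, i \in D -> i \notin C -> 2 <= b i)%N ->
  in_square D b = in_square C a.
Proof.
move=> /subsetP sCD eq_ab ge2.
apply/in_squareP/in_squareP => -[F [G [FH GH le]]];
  exists F, G; split=> // i iC.
  by rewrite eq_ab //; apply: le; apply: sCD.
have [iC'|/(ge2 _ iC)] := boolP (i \in C).
  by rewrite -eq_ab //; apply: le.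
by case: (i \in F); case: (i \in G) => /=; lia.
Qed.

Lemma edge_ideal_sqrP (f : {mpoly k[n]}) :
  ideal_mul (edge_ideal k H) (edge_ideal k H) f
  <-> monomial_ideal (fun m : 'X_{1..n} => in_square setT m) f.
Proof.
split; last first.
  apply: monomial_ideal_sub; first exact: ideal_gen_ideal.
  move=> m /in_squareP [F [G [FH GH le]]].
  have le_m : (mesym1 F + mesym1 G <= m)%MM.
    by apply/mnm_lepP=> i; rewrite mnmDE !mnmE; apply: le; rewrite inE.
  rewrite -(submK le_m) !mpolyXD -!sqfree_monomialE.
  have [_ _] := ideal_gen_ideal (fun x : {mpoly k[n]} =>
    exists y z, [/\ edge_ideal k H y, edge_ideal k H z & x = y * z]).
  apply; apply: ideal_gen_mem.
  by exists (sqfree_monomial k F), (sqfree_monomial k G); split=> //;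
    apply: ideal_gen_mem; [exists F | exists G].
have edge_sub : forall x, edge_ideal k H x -> monomial_ideal
    (fun m => exists2 F, F \in H & (mesym1 F <= m)%MM) x.
  apply: ideal_gen_sub => [|_ [F FH ->]].
    apply: monomial_ideal_ideal => m m' [F FH leF]; exists F => //.
    by apply: lepm_trans leF _; apply/mnm_lepP => i; rewrite mnmDE leq_addl.
  by rewrite sqfree_monomialE; apply: monomial_idealX; exists F; last exact: lepm_refl.
apply: ideal_gen_sub => [|_ [x [y [/edge_sub xH /edge_sub yH ->]]]].
  apply: monomial_ideal_ideal => m m'; apply: in_square_le => i _.
  by left; rewrite mnmDE leq_addl.
move=> _ /msuppM_le /allpairsP [[m m'] /= [/xH [F FH leF] /yH [G GH leG] ->]].
apply/in_squareP; exists F, G; split=> // i _.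
have := mnm_lepP leF i; have := mnm_lepP leG i.
by rewrite mnmDE !mnmE => leG' leF'; rewrite leq_add.
Qed.

Definition indicator U (i : 'I_n) : nat := i \in U.

Lemma decomposable_inducedP C U :
  decomposable (induced_hypergraph H C) U <-> in_square C (indicator U).
Proof.
split.
  move=> [U1 [U2 [<- disU [_ /imsetP [F FH ->] sF] [_ /imsetP [G GH ->] sG]]]].
  apply/in_squareP; exists F, G; split=> // i iC; rewrite /indicator.
  move: (subsetP sF i) (subsetP sG i) (disjointFr disU (x := i)).
  rewrite !inE iC !andbT.
  case: (i \in F); case: (i \in G); case: (i \in U1); case: (i \in U2) => //=;
    by [move=> /(_ isT) | move=> _ /(_ isT) | move=> _ _ /(_ isT)].
move=> /in_squareP [F [G [FH GH le]]].
(* The trace of [F] is one part; the rest of [U] contains the trace of [G], since an indicator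
   leaves no room for a common vertex. *)
exists (F :&: C), (U :\: (F :&: C)); split.
- apply/setP=> i; rewrite !inE; have := le i; rewrite /indicator.
  by case: (i \in F); case: (i \in G); case: (i \in C); case: (i \in U) => //=;
     move=> /(_ isT).
- rewrite -setI_eq0; apply/eqP/setP=> i; rewrite !inE.
  by case: (i \in F); case: (i \in C).
- by exists (F :&: C) => //; apply: imset_f.
- exists (G :&: C); first exact: imset_f.
  apply/subsetP=> i; rewrite !inE; have := le i; rewrite /indicator.
  by case: (i \in F); case: (i \in G); case: (i \in C); case: (i \in U) => //=;
     move=> /(_ isT).
Qed.

(** Deleting [i] from the edges of [H_C] means inducing on [C :\ i], that is, inverting [x_i];
    adding 2 to its exponent has the same effect. *)
Lemma decomposable_removeP C U i : i \in C ->
  decomposable (remove_vertex (induced_hypergraph H C) i) (U :\ i)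
  <-> in_square C (fun j => indicator U j + (j == i).*2)%N.
Proof.
move=> iC.
have -> : remove_vertex (induced_hypergraph H C) i
          = induced_hypergraph H (C :\ i).
  rewrite /remove_vertex /induced_hypergraph -imset_comp.
  by apply: eq_imset => F /=; rewrite setIDA.
rewrite (@in_square_invert (C :\ i) C (indicator (U :\ i))).
- exact: decomposable_inducedP.
- exact: subD1set.
- by move=> j; rewrite /indicator !inE => /andP [/negbTE -> _]; rewrite addn0.
- by move=> j jC; rewrite !inE jC andbT negbK => ->; rewrite leq_addl.
Qed.

Lemma two_saturating_exponentP C :
  (exists U, two_saturating C (induced_hypergraph H C) U) <->
  (exists a, ~~ in_square C a /\
     forall i, i \in C -> in_square C (fun j => a j + (j == i))%N).
Proof.
split=> [[U [sUC indecU satU]] | [a [aN aS]]].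
- pose P D := ~~ in_square C (fun j => indicator U j + indicator D j)%N.
  have P0 : P set0.
    apply: contra_notN indecU => U0; apply/decomposable_inducedP.
    by apply: in_square_le U0 => j _; left; rewrite {2}/indicator inE addn0.
  have [D /maxsetP [PD Dmax] _] := maxset_exists P0.
  exists (fun j => indicator U j + indicator D j)%N; split=> // i iC.
  (* On [D] the exponent is already raised by 1, so one more unit gives the 2 of saturation; off
     [D], maximality of [D] applies. *)
  have [iD|iD] := boolP (i \in D).
    apply: in_square_le (iffLR (decomposable_removeP U iC) (satU i iC)) => j _.
    left; rewrite -addnA leq_add2l.
    by case: eqP => // ->; rewrite /indicator iD.
  apply: contraNT iD => PiD; rewrite -(Dmax (i |: D)) ?setU11 ?subsetUr //.
  apply: contraNN PiD; apply: in_square_le => j _; left.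
  rewrite -addnA leq_add2l /indicator !inE.
  by case: (j == i); case: (j \in D).
- have a_le1 i : i \in C -> (a i <= 1)%N.
    (* If [a i] were at least 2, raising it further could not create membership. *)
    move=> iC; rewrite leqNgt; apply: contraNN aN => a_ge2.
    apply: in_square_le (aS i iC) => j _; case: eqP => [->|_]; first by right.
    by left; rewrite addn0.
  exists [set i in C | 0 < a i]%N; split.
  + by apply/subsetP => i; rewrite inE => /andP [].
  + move=> /decomposable_inducedP; apply/negP; apply: contraNN aN.
    apply: in_square_le => i iC; left; rewrite /indicator inE iC /=.
    by case: (a i).
  + move=> i iC; apply/decomposable_removeP => //.
    apply: in_square_le (aS i iC) => j jC; left.
    rewrite /indicator inE jC /=; have := a_le1 j jC.
    by case: (a j) => [|[|]] //; case: (j == i).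
Qed.

End SquareOfEdgeIdeal.

(** * Primality of ideals generated by variables *)

Section VariableIdeal.
Set Implicit Arguments.
Unset Strict Implicit.
Variables (k : fieldType) (n : nat) (C : {set 'I_n}).

Lemma variable_idealP (f : {mpoly k[n]}) :
  variable_ideal k C f
  <-> monomial_ideal (fun m : 'X_{1..n} => exists2 i, i \in C & m i != 0)%N f.
Proof.
split.
  apply: ideal_gen_sub => [|_ [i iC ->]].
    apply: monomial_ideal_ideal => m m' [i iC mi]; exists i => //.
    by rewrite mnmDE addn_eq0 negb_and mi orbT.
  by apply: monomial_idealX; exists i => //; rewrite mnm1E eqxx.
apply: monomial_ideal_sub; first exact: ideal_gen_ideal.
move=> m [i iC]; rewrite -lep1mP => le_m; rewrite -(submK le_m) mpolyXD.
have [_ _] := ideal_gen_ideal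
  (fun g : {mpoly k[n]} => exists2 i, i \in C & g = 'X_i).
by apply; apply: ideal_gen_mem; exists i.
Qed.

Definition kill_vars : n.-tuple {mpoly k[n]} :=
  [tuple if i \in C then 0 else 'X_i | i < n].

(** The substitution kills the monomials involving a variable of [C] and fixes all others. *)
Lemma variable_ideal_ker (f : {mpoly k[n]}) :
  variable_ideal k C f <-> f \mPo kill_vars = 0.
Proof.
have killX m : 'X_[m] \mPo kill_vars
    = if [exists i in C, m i != 0%N] then 0 else 'X_[m].
  rewrite comp_mpolyX; case: ifPn => [/exists_inP [i iC mi]|].
    by rewrite (bigD1 i) //= tnth_mktuple iC expr0n (negbTE mi) mul0r.
  rewrite negb_exists_in => /forall_inP m0; rewrite mpolyXE_id.
  apply: eq_bigr => i _; rewrite tnth_mktuple; case: ifP => // iC.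
  by have /eqP -> := negbNE (m0 i iC); rewrite !expr0.
split=> [/variable_idealP fC | f0].
  rewrite comp_mpolyEX big_seq big1 // => m /fC [i iC mi].
  by rewrite killX ifT ?scaler0 //; apply/exists_inP; exists i.
(* Subtracting the zero image of [f] term by term leaves only the terms involving a variable of
   [C]. *)
rewrite -[f]subr0 -f0 {1}[f]mpolyE comp_mpolyEX -sumrB.
apply: ideal_sum => [|m _]; first exact: ideal_gen_ideal.
have [I0 _ _] := ideal_gen_ideal
  (fun g : {mpoly k[n]} => exists2 i, i \in C & g = 'X_i).
rewrite -scalerBr killX; case: exists_inP => [mC|_]; last first.
  by rewrite subrr scaler0.
rewrite subr0; apply/variable_idealP => m' /msuppZ_le.
by rewrite msuppX inE => /eqP ->.
Qed.

(** A kernel of a ring morphism into a domain is prime. *)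
Lemma variable_ideal_prime : is_prime_ideal (variable_ideal k C).
Proof.
split; first exact: ideal_gen_ideal.
  by move=> /variable_ideal_ker /eqP; rewrite comp_mpoly1 oner_eq0.
move=> f g /variable_ideal_ker /eqP; rewrite rmorphM mulf_eq0.
by case/orP=> /eqP fg0; [left | right]; apply/variable_ideal_ker.
Qed.

End VariableIdeal.

Theorem theorem3p1 (k : fieldType) (n : nat) (H : {set {set 'I_n}})
    (C : {set 'I_n}) :
  associated_prime_quot
    (ideal_mul (edge_ideal k H) (edge_ideal k H)) (variable_ideal k C)
  <-> exists U : {set 'I_n}, two_saturating C (induced_hypergraph H C) U.
Proof.
rewrite two_saturating_exponentP.
(* [h] is the exponent of the squared product of the variables outside [C]. *)
pose h : 'X_{1..n} := [multinom (i \notin C).*2 | i < n].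
have inv_h (m : 'X_{1..n}) :
    in_square H setT (m + h)%MM = in_square H C m.
  apply: in_square_invert => [|i iC|i _ iC]; first exact: subsetT.
    by rewrite mnmDE mnmE iC addn0.
  by rewrite mnmDE mnmE iC leq_addl.
split=> [[_ [f fP]] | [a [aN aS]]].
- have hNP : ~ variable_ideal k C 'X_[h].
    move=> /variable_idealP /(_ h); rewrite msuppX mem_seq1 eqxx => /(_ isT).
    by case=> i iC; rewrite mnmE iC.
  (* Otherwise [x^h f] would lie in the square, putting [x^h] in the annihilator of [f]. *)
  have /hasP [m mf mN] : has (fun m : 'X_{1..n} => ~~ in_square H C m) (msupp f).
    apply: contra_notT hNP; rewrite -all_predC => /allP fC.
    apply/fP/edge_ideal_sqrP => m; rewrite mulrC (perm_mem (msuppMX _ _)).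
    by move=> /mapP [m' /fC /negbNE m'C ->]; rewrite addmC inv_h.
  exists m; split=> // i iC.
  have /fP /edge_ideal_sqrP : variable_ideal k C ('X_i * 'X_[h]).
    apply/variable_idealP => m'; rewrite -mpolyXD msuppX inE => /eqP ->.
    by exists i; rewrite // mnmDE mnm1E eqxx.
  (* Multiplying by a monomial shifts the support injectively, so the term of [f] at [m] survives in
     the product. *)
  move=> /(_ (m + U_(i) + h)%MM); rewrite -mpolyXD mulrC inv_h.
  rewrite (perm_mem (msuppMX _ _)) -addmA [(m + _)%MM]addmC map_f // => /(_ isT).
  by apply: in_square_le => j _; left; rewrite mnmDE mnm1E eq_sym.
- split; first exact: variable_ideal_prime.
  pose m : 'X_{1..n} := [multinom a i | i < n].
  exists 'X_[m + h] => g; split=> [/variable_idealP gC | ].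
    apply/edge_ideal_sqrP => m'; rewrite (perm_mem (msuppMX _ _)) => /mapP.
    case=> u /gC [i iC ui] -> {m'}.
    rewrite [(m + h + u)%MM]addmC addmA inv_h.
    apply: in_square_le (aS i iC) => j _; left; rewrite mnmDE mnmE addnC.
    by rewrite leq_add2r; case: eqP => // ->; rewrite lt0n.
  move=> /edge_ideal_sqrP gI; apply/variable_idealP => m' m'g.
  have /gI : (m + h + m')%MM \in msupp (g * 'X_[m + h]).
    by rewrite (perm_mem (msuppMX _ _)) map_f.
  rewrite [(m + h + m')%MM]addmC addmA inv_h => m'S.
  (* A term of [g] free of the variables of [C] would leave the exponent [a] unchanged on [C]. *)
  apply/exists_inP; apply: contraNT aN; rewrite negb_exists_in.
  move=> /forall_inP m'0; apply: in_square_le m'S => i iC; left.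
  by rewrite mnmDE mnmE (eqP (negbNE (m'0 i iC))).
Qed.
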